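(* Assume the standing setting described in the context, with $\nu = 0$ (i.e. $g$ is merely assumed proper, convex and lower semicontinuous). Let $c_{\alpha} > L_{yx} \geq 0$ and $\tau, \sigma > 0$ be such that $$\left( c_{\alpha} L_{yx} \tau + 2 L_{yy} \right) \sigma < 1.$$ Let $(x_k,y_k)_{k\ge 0}$ be the sequence generated by the algorithm OGAProx with the constant parameters $\tau_k = \tau$, $\sigma_k = \sigma$, $\theta_k = 1$ for all $k \geq 0$. Then $(x_k,y_k)_{k\ge 0}$ converges weakly to a saddle point $(x^{\ast},y^{\ast}) \in \mathcal{H}\times\mathcal{G}$ of the problem $\min_{x\in\mathcal{H}}\max_{y\in\mathcal{G}} \Psi(x,y)$. Furthermore, for $K \geq 1$ denote $$\bar{x}_{K} = \frac{1}{K} \sum_{k=0}^{K-1} x_{k+1}, \qquad \bar{y}_{K} = \frac{1}{K} \sum_{k=0}^{K-1} y_{k+1}.$$ Then for all $K \geq 1$ and any saddle point $(x^{\ast},y^{\ast}) \in \mathcal{H}\times\mathcal{G}$ of the problem we have $$0 \leq \Psi(\bar{x}_{K},y^{\ast}) - \Psi(x^{\ast},\bar{y}_{K}) \leq \frac{1}{K} \left( \frac{1}{2 \tau} \|x^{\ast}-x_{0}\|^{2} + \frac{1}{2 \sigma} \|y^{\ast}-y_{0}\|^{2} \right).$$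
   Context: Setting. $\mathcal{H},\mathcal{G}$ are real Hilbert spaces, $\Phi:\mathcal{H}\times\mathcal{G}\to\mathbb{R}\cup\{+\infty\}$ with $\operatorname{dom}\Phi := \{(x,y) : \Phi(x,y)<+\infty\}\neq\emptyset$, and $g:\mathcal{G}\to\mathbb{R}\cup\{+\infty\}$ with $\operatorname{dom} g := \{y : g(y)<+\infty\}$. Put $P := \Pr_{\mathcal{H}}(\operatorname{dom}\Phi) := \{u\in\mathcal{H} : \exists y\in\mathcal{G},\ (u,y)\in\operatorname{dom}\Phi\}$. Standing assumptions: (i) $g$ is proper, lower semicontinuous and convex with modulus $\nu\ge 0$, i.e. $g-\frac{\nu}{2}\|\cdot\|^2$ is convex; (ii) for all $y\in\operatorname{dom} g$, $\Phi(\cdot,y):\mathcal{H}\to\mathbb{R}\cup\{+\infty\}$ is proper, convex and lower semicontinuous; (iii) for all $x\in P$, $\operatorname{dom}\Phi(x,\cdot)=\mathcal{G}$ and $\Phi(x,\cdot):\mathcal{G}\to\mathbb{R}$ is concave and Fréchet differentiable, with gradient at $y$ denoted $\nabla_y\Phi(x,y)$; moreover $P$ is closed; (iv) $L_{yx},L_{yy}\ge 0$ are constants such that for all $(x,y),(x',y')\in P\times\operatorname{dom} g$: $\|\nabla_y\Phi(x,y)-\nabla_y\Phi(x',y')\|\le L_{yx}\|x-x'\|+L_{yy}\|y-y'\|$. The objective is $\Psi(x,y) := \Phi(x,y)-g(y)$ with the convention $+\infty-(+\infty):=+\infty$; thus $\Psi(x,y)=-\infty$ if $x\in P$, $y\notin\operatorname{dom}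 g$; $\Psi(x,y)=\Phi(x,y)-g(y)\in\mathbb{R}$ if $x\in P$, $y\in\operatorname{dom} g$; $\Psi(x,y)=+\infty$ if $x\notin P$. A saddle point is a point $(x^*,y^* )\in\mathcal{H}\times\mathcal{G}$ with $\Psi(x^*,y)\le\Psi(x^*,y^* )\le\Psi(x,y^* )$ for all $(x,y)\in\mathcal{H}\times\mathcal{G}$. It is assumed that a saddle point exists. For a proper, convex, lower semicontinuous $f$ on a real Hilbert space, $\operatorname{prox}_f(x):=\operatorname{argmin}_u\{f(u)+\frac12\|u-x\|^2\}$. Algorithm OGAProx. Given $x_0\in P$, $y_0\in\operatorname{dom} g$, with $x_{-1}:=x_0$, $y_{-1}:=y_0$, and parameters $\sigma_k,\tau_k>0$, $\theta_k\in(0,1]$, for all $k\ge 0$: $y_{k+1}:=\operatorname{prox}_{\sigma_k g}\big(y_k+\sigma_k[(1+\theta_k)\nabla_y\Phi(x_k,y_k)-\theta_k\nabla_y\Phi(x_{k-1},y_{k-1})]\big)$, $x_{k+1}:=\operatorname{prox}_{\tau_k\Phi(\cdot,y_{k+1})}(x_k)$. *)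

(* Defs.v *)
From HB Require Import structures.
From mathcomp Require Import all_boot all_order all_algebra.
From mathcomp Require Import all_classical all_reals all_analysis.

Set Implicit Arguments.
Unset Strict Implicit.
Unset Printing Implicit Defensive.

Import Order.TTheory GRing.Theory Num.Theory.
Import numFieldNormedType.Exports.

Local Open Scope classical_set_scope.
Local Open Scope ring_scope.

HB.mixin Record NormedModule_hasInner (R : realType) H
    of NormedModule R H := {
  inner : {dot H for idfun} ;
  inner_norm : forall x : H, inner x x = `|x| ^+ 2
}.

#[short(type="hilbertType")]
HB.structure Definition Hilbert (R : realType) :=
  {H of CompleteNormedModule R H & NormedModule_hasInner R H}.

(* Weak convergence is tested against all continuous linear functionals, so
   that it applies verbatim to the product of two Hilbert spaces; the library
   norm on the product (the max norm) is equivalent to the Hilbertian one,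
   hence both have the same functionals. *)
Definition weak_cvg (R : realType) (V : normedModType R)
    (u : nat -> V) (l : V) : Prop :=
  forall f : {linear V -> R^o}, continuous f -> f (u n) @[n --> \oo] --> f l.

(* The Riesz representative of the Frechet derivative; meaningful only where
   [f] is differentiable. *)
Definition gradient (R : realType) (V : hilbertType R) (f : V -> R^o) (y : V)
    : V :=
  get [set v | forall h, 'd f y h = inner v h].

Section extended_real_functions.
Context {R : realType}.
Local Open Scope ereal_scope.

Definition edom (T : Type) (f : T -> \bar R) : set T := [set x | f x < +oo].

Definition proper (T : Type) (f : T -> \bar R) : Prop :=
  (forall x, f x != -oo) /\ edom f !=set0.

(* The library's [convex_function] only covers real-valued functions. This is
   used for functions that never take the value -oo; as 0 * +oo = 0 in \bar R,
   the right-hand side is then never of the form +oo - oo. *)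
Definition econvex (V : lmodType R) (f : V -> \bar R) : Prop :=
  forall (u v : V) (t : R), (0 <= t <= 1)%R ->
    f (t *: u + (1 - t) *: v)%R <= t%:E * f u + (1 - t)%:E * f v.

Definition convex_modulus (V : normedModType R) (nu : R) (f : V -> \bar R)
    : Prop :=
  econvex (fun u => f u - (nu / 2 * `|u| ^+ 2)%:E).

Definition argmin (T : Type) (f : T -> \bar R) : set T :=
  [set p | forall u, f p <= f u].

(* For [f] proper, convex and lower semicontinuous the set of minimisers is a
   singleton, and [get] selects its element. *)
Definition prox (V : hilbertType R) (f : V -> \bar R) (v : V) : V :=
  get (argmin (fun u => f u + (1 / 2 * `|u - v| ^+ 2)%:E)).

End extended_real_functions.

Section minimax.
Context {R : realType} {H G : hilbertType R}.
Variables (Phi : H -> G -> \bar R) (g : G -> \bar R).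

Definition dom_fst : set H := [set u | exists v, (Phi u v < +oo)%E].

Definition grad_y (u : H) (v : G) : G := gradient (fine \o Phi u) v.

Record standing_assumptions (nu Lyx Lyy : R) : Prop := {
  Phi_Nninfty : forall u v, Phi u v != -oo%E ;
  Phi_dom : exists u v, (Phi u v < +oo)%E ;
  g_proper : proper g ;
  g_lsc : lower_semicontinuous g ;
  nu_ge0 : 0 <= nu ;
  g_convex : convex_modulus nu g ;
  Phi_fst_proper : forall v, edom g v -> proper (Phi^~ v) ;
  Phi_fst_convex : forall v, edom g v -> econvex (Phi^~ v) ;
  Phi_fst_lsc : forall v, edom g v -> lower_semicontinuous (Phi^~ v) ;
  Phi_snd_dom : forall u, dom_fst u -> edom (Phi u) = setT ;
  Phi_snd_concave : forall u, dom_fst u -> econvex (fun v => - Phi u v)%E ;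
  Phi_snd_diff : forall u, dom_fst u ->
    forall v, differentiable (fine \o Phi u : G -> R^o) v ;
  dom_fst_closed : closed dom_fst ;
  Lyx_ge0 : 0 <= Lyx ;
  Lyy_ge0 : 0 <= Lyy ;
  grad_y_lipschitz : forall u u' v v',
    dom_fst u -> dom_fst u' -> edom g v -> edom g v' ->
    `|grad_y u v - grad_y u' v'| <= Lyx * `|u - u'| + Lyy * `|v - v'|
}.

(* The convention is +oo - (+oo) = +oo, whereas +oo - +oo = -oo in \bar R. *)
Definition Psi (u : H) (v : G) : \bar R :=
  (if Phi u v == +oo then +oo else Phi u v - g v)%E.

Definition saddle_point (us : H) (vs : G) : Prop :=
  forall u v, (Psi us v <= Psi us vs)%E /\ (Psi us vs <= Psi u vs)%E.

(* [k.-1] is the truncated predecessor, so that index -1 stands for index 0. *)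
Record OGAProx (tau sigma theta : nat -> R) (x : nat -> H) (y : nat -> G)
    : Prop := {
  OGAProx_x0 : dom_fst (x 0%N) ;
  OGAProx_y0 : edom g (y 0%N) ;
  OGAProx_tau : forall k, 0 < tau k ;
  OGAProx_sigma : forall k, 0 < sigma k ;
  OGAProx_theta : forall k, 0 < theta k <= 1 ;
  OGAProx_y : forall k,
    y k.+1 = prox (fun v => (sigma k)%:E * g v)%E
      (y k + sigma k *: ((1 + theta k) *: grad_y (x k) (y k)
                         - theta k *: grad_y (x k.-1) (y k.-1))) ;
  OGAProx_x : forall k,
    x k.+1 = prox (fun u => (tau k)%:E * Phi u (y k.+1))%E (x k)
}.

End minimax.

Definition ergodic_mean (R : realType) (V : lmodType R) (z : nat -> V) (K : nat)
    : V :=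
  K%:R^-1 *: \sum_(0 <= k < K) z k.+1.

(* Main.v *)
(* The two proximal steps and the concavity of [Phi u] bound the primal-dual gap
   at step [k + 1] by the decrease of an energy: the weighted squared distance
   to the reference point plus inertial terms. This energy dominates a positive
   multiple of the squared distance, so at a saddle point the steps vanish and
   the distances converge; summing and Jensen's inequality give the ergodic rate.
   For the weak limit, Opial's argument is run with ultrafilters instead of
   subsequences: along an ultrafilter a bounded sequence has weak limits by the
   compactness of segments and Riesz representation, and every such limit is a
   saddle point by weak lower semicontinuity. Riesz representation and weak lower
   semicontinuity are both read off the variational inequality of [prox]. *)

From mathcomp Require Import all_boot all_order all_algebra.
From mathcomp Require Import all_classical all_reals all_analysis.
From mathcomp Require Import ring lra.
Require Import Defs.

Set Implicit Arguments.
Unset Strict Implicit.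
Unset Printing Implicit Defensive.

Import Order.TTheory GRing.Theory Num.Theory.
Import numFieldNormedType.Exports.

Local Open Scope classical_set_scope.
Local Open Scope ring_scope.

(** * Inner product identities and the Cauchy-Schwarz inequality *)

Section inner_product.
Context {R : realType} {V : hilbertType R}.
Implicit Types u v w : V.

Lemma innerC u v : inner u v = inner v u.
Proof. by rewrite hermC expr0 mul1r. Qed.

Lemma innerDl u v w : inner (u + v) w = inner u w + inner v w.
Proof. exact: linearDl. Qed.

Lemma innerDr u v w : inner w (u + v) = inner w u + inner w v.
Proof. exact: linearDr. Qed.

Lemma innerNl u w : inner (- u) w = - inner u w.
Proof. exact: linearNl. Qed.

Lemma innerNr u w : inner w (- u) = - inner w u.
Proof. exact: linearNr. Qed.

Lemma innerZl a u w : inner (a *: u) w = a * inner u w.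
Proof. exact: linearZl_LR. Qed.

Lemma innerZr a u w : inner w (a *: u) = a * inner w u.
Proof. by rewrite innerC innerZl innerC. Qed.

Lemma inner0l w : inner 0 w = 0.
Proof. exact: linear0l. Qed.

Lemma inner0r w : inner w 0 = 0.
Proof. exact: linear0r. Qed.

Definition innerE :=
  (innerDl, innerDr, innerNl, innerNr, innerZl, innerZr, inner0l, inner0r).

Lemma sqr_normD u v : `|u + v| ^+ 2 = `|u| ^+ 2 + 2 * inner u v + `|v| ^+ 2.
Proof. by rewrite -!inner_norm !innerE (innerC v u); ring. Qed.

Lemma sqr_normB u v : `|u - v| ^+ 2 = `|u| ^+ 2 - 2 * inner u v + `|v| ^+ 2.
Proof. by rewrite sqr_normD normrN innerNr; ring. Qed.

Lemma parallelogram u v :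
  `|u + v| ^+ 2 + `|u - v| ^+ 2 = 2 * `|u| ^+ 2 + 2 * `|v| ^+ 2.
Proof. by rewrite sqr_normD sqr_normB; ring. Qed.

Lemma CauchySchwarz_inner u v : `|inner u v| <= `|u| * `|v|.
Proof.
have ge0 a b : 0 <= a ^+ 2 * `|u| ^+ 2 + 2 * (a * b) * inner u v
    + b ^+ 2 * `|v| ^+ 2.
  have := sqr_ge0 `|a *: u + b *: v|.
  by rewrite sqr_normD !normrZ !exprMn !real_normK ?num_real// !innerE;
    congr (_ <= _); ring.
have [->|u0] := eqVneq u 0; first by rewrite inner0l !normr0 mul0r.
have up : 0 < `|u| ^+ 2 by rewrite exprn_gt0// normr_gt0.
rewrite -ler_sqr ?nnegrE ?mulr_ge0// real_normK ?num_real// exprMn.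
(* With [b = |u|^2] fixed, this [a] minimises the form; the value is [|u|^2] times the
   Cauchy-Schwarz defect. *)
have := ge0 (- inner u v) (`|u| ^+ 2).
have -> : (- inner u v) ^+ 2 * `|u| ^+ 2 +
    2 * (- inner u v * `|u| ^+ 2) * inner u v + (`|u| ^+ 2) ^+ 2 * `|v| ^+ 2
  = `|u| ^+ 2 * (`|u| ^+ 2 * `|v| ^+ 2 - inner u v ^+ 2) by ring.
by rewrite pmulr_rge0// subr_ge0.
Qed.

Lemma ler_inner u v : inner u v <= `|u| * `|v|.
Proof. exact: le_trans (ler_norm _) (CauchySchwarz_inner u v). Qed.

Lemma three_point u v w :
  2 * inner (u - v) (w - v) = `|u - v| ^+ 2 + `|w - v| ^+ 2 - `|w - u| ^+ 2.
Proof.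
have -> : w - u = (w - v) - (u - v) by rewrite opprB addrA subrK.
by rewrite (sqr_normB (w - v)) (innerC (u - v)); ring.
Qed.

End inner_product.

(** * Convex functions with extended real values *)

Section extended_convex.
Context {R : realType}.

Lemma proper_fineK (T : Type) (f : T -> \bar R) u :
  proper f -> edom f u -> (fine (f u))%:E = f u.
Proof.
by move=> [fN _] fu; rewrite fineK// fin_numE fN lt_eqF.
Qed.

Lemma notin_edom (T : Type) (f : T -> \bar R) u : ~ edom f u -> f u = +oo%E.
Proof. by rewrite /edom/= => /negP; rewrite -leNgt leye_eq => /eqP. Qed.

Lemma edom_convex (V : lmodType R) (f : V -> \bar R) u w t :
  proper f -> econvex f -> edom f u -> edom f w -> 0 <= t <= 1 ->
  edom f (t *: u + (1 - t) *: w) /\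
  fine (f (t *: u + (1 - t) *: w)) <= t * fine (f u) + (1 - t) * fine (f w).
Proof.
move=> pf cf fu fw t01; have := cf u w t t01.
rewrite -(proper_fineK pf fu) -(proper_fineK pf fw) -!EFinM -EFinD => le_f.
have ft : edom f (t *: u + (1 - t) *: w) by exact: le_lt_trans le_f (ltry _).
by split=> //; rewrite -lee_fin (proper_fineK pf ft).
Qed.

Lemma properZ (T : Type) (f : T -> \bar R) a : 0 < a ->
  proper f -> proper (fun u => a%:E * f u)%E.
Proof.
move=> a0 pf; have [fN [u fu]] := pf; split.
  move=> w; have := fN w; case: (f w) => [r| |] // _.
  by rewrite gt0_muley ?lte_fin.
by exists u; rewrite /edom/= -(proper_fineK pf fu) -EFinM ltry.
Qed.

Lemma econvexZ (V : lmodType R) (f : V -> \bar R) a : 0 < a ->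
  proper f -> econvex f -> econvex (fun u => a%:E * f u)%E.
Proof.
move=> a0 [fN _] cf u w t /andP[t0 t1].
have Nninfty (s : R) x : 0 <= s -> f x != -oo%E -> (s%:E * f x != -oo)%E.
  rewrite le_eqVlt => /predU1P[<-|s0]; first by rewrite mul0e.
  by case: (f x) => [r| |] //; rewrite gt0_muley ?lte_fin.
have a0' : (0 <= a%:E)%E by rewrite lee_fin ltW.
apply: le_trans (lee_wpmul2l a0' (cf u w t _)) _; first by rewrite t0.
rewrite muleDr//; last first.
  by rewrite /adde_def !(negbTE (Nninfty _ _ _ (fN _))) ?subr_ge0 ?andbF.
by rewrite !muleA -!EFinM ![(a * _)%R]mulrC.
Qed.

Lemma edomZ (T : Type) (f : T -> \bar R) a : 0 < a ->
  edom (fun u => a%:E * f u)%E = edom f.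
Proof.
move=> a0; apply/seteqP; split=> u; rewrite /edom/=.
  case: (f u) => [r| |]; rewrite ?ltry ?ltNyy//.
  by rewrite gt0_muley ?lte_fin.
case: (f u) => [r| |]; rewrite ?ltxx ?ltNyy// ?ltry// => _.
by rewrite gt0_muleNy ?lte_fin.
Qed.

Lemma lower_semicontinuousZ (V : topologicalType) (f : V -> \bar R) a : 0 < a ->
  lower_semicontinuous f -> lower_semicontinuous (fun u => a%:E * f u)%E.
Proof.
move=> a0 lf u b bf.
have lt_divr (w : V) : (b%:E < a%:E * f w)%E = ((b / a)%:E < f w)%E.
  case: (f w) => [r| |].
  - by rewrite -EFinM !lte_fin ltr_pdivrMr// mulrC.
  - by rewrite gt0_muley ?lte_fin// !ltry.
  - by rewrite gt0_muleNy ?lte_fin// !ltNge !leNye.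
have [|W uW fW] := lf u (b / a); first by rewrite -lt_divr.
by exists W => // w /fW; rewrite lt_divr.
Qed.

End extended_convex.

(** * Existence of proximal points and their variational inequality *)

Section prox_existence.
Context {R : realType} {V : hilbertType R}.
Variable f : V -> \bar R.
Hypotheses (pf : proper f) (cf : econvex f) (lf : lower_semicontinuous f).

(** Lower semicontinuity keeps [f] above [f u0 - 1] on a ball of radius [e]. For [u] outside it,
    convexity on the segment from [u0] to [u], tested at distance [e / 2] from [u0], permits at most
    linear decrease with slope [2 / e]. This makes the prox objective bounded below. *)
Lemma econvex_minorant u0 : edom f u0 ->
  exists2 d, 0 < d &
    forall u, edom f u -> fine (f u0) - 1 - `|u - u0| / d <= fine (f u).
Proof.
move=> fu0; have fu0_gt : ((fine (f u0) - 1)%:E < f u0)%E.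
  by rewrite -[ltRHS](proper_fineK pf fu0) lte_fin ltrBlDr ltrDl.
have [W /nbhs_normP[e /= e0 eW] fW] := lf fu0_gt.
exists (e / 2); first by rewrite divr_gt0.
move=> u fu; have [near_u|far_u] := ltP `|u - u0| e.
  have : ((fine (f u0) - 1)%:E < f u)%E by apply/fW/eW; rewrite /= distrC.
  rewrite -[ltRHS](proper_fineK pf fu) lte_fin => /ltW; apply: le_trans.
  by rewrite lerBlDr lerDl divr_ge0// divr_ge0// ltW.
have n0 : 0 < `|u - u0| by exact: lt_le_trans far_u.
set t := e / 2 / `|u - u0|.
have t0 : 0 < t by rewrite !divr_gt0.
have t1 : t <= 1.
  rewrite /t ler_pdivrMr// mul1r (le_trans _ far_u)//.
  by rewrite ler_pdivrMr// ler_peMr ?ltW// ltr1n.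
have t01 : 0 <= t <= 1 by rewrite ltW.
have [fw le_fw] := edom_convex pf cf fu fu0 t01.
have : ((fine (f u0) - 1)%:E < f (t *: u + (1 - t) *: u0)%R)%E.
  apply/fW/eW => /=.
  have -> : u0 - (t *: u + (1 - t) *: u0) = - (t *: (u - u0)).
    by rewrite scalerBl scale1r scalerBr !opprD !opprK addrCA addNKr addrC.
  rewrite normrN normrZ gtr0_norm// /t divfK ?gt_eqF//.
  by rewrite ltr_pdivrMr// ltr_pMr// ltr1n.
rewrite -[ltRHS](proper_fineK pf fw) lte_fin => lt_fw.
have {le_fw lt_fw} h : t * (fine (f u0) - fine (f u)) <= 1 by lra.
have -> : `|u - u0| / (e / 2) = t^-1 by rewrite /t [RHS]invf_div.
have : fine (f u0) - fine (f u) <= t^-1.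
  by rewrite -[leRHS]mul1r ler_pdivlMr// mulrC.
lra.
Qed.

(** The quadratic term makes near-minimisers cluster: the sets [B e] have diameter tending to 0 with
    [e] and generate a Cauchy filter, whose limit is a minimiser by lower semicontinuity. *)
Lemma prox_argmin_neq0 v :
  argmin (fun u => f u + (1 / 2 * `|u - v| ^+ 2)%:E)%E !=set0.
Proof.
have [_ [u0 fu0]] := pf.
pose F u := fine (f u) + 1 / 2 * `|u - v| ^+ 2.
have [d d0 le_f] := econvex_minorant fu0.
(* The last term comes from completing the square in [s^2 / 2 - s / d] with [s = |u - v|]. *)
pose lb := fine (f u0) - 1 - `|v - u0| / d - 1 / 2 * d^-1 ^+ 2.
have lbF : lbound [set F u | u in edom f] lb.
  move=> _ [u fu <-]; rewrite /F /lb; have := le_f u fu.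
  have : `|u - u0| / d <= `|u - v| / d + `|v - u0| / d.
    rewrite -mulrDl ler_pM2r ?invr_gt0//.
    by rewrite -(subrKA v u (- u0)) ler_normD.
  have := sqr_ge0 (`|u - v| - d^-1); move: (`|u - v|) => s; nra.
have F0 : [set F u | u in edom f] !=set0 by exists (F u0), u0.
set m := inf [set F u | u in edom f].
have mF u : edom f u -> m <= F u.
  by move=> fu; apply: ge_inf; [exists lb|exists u].
pose B e := [set u | edom f u /\ F u < m + e].
have B0 e : 0 < e -> B e !=set0.
  move=> e0.
  have [|_ [u fu <-] Fu] := inf_adherent (E := [set F u | u in edom f]) e0.
    by split=> //; exists lb.
  by exists u.
(* At the midpoint of [u] and [w] the objective is at least [m] and, by the parallelogram law, at
   most the mean of [F u] and [F w] minus [|u - w|^2 / 8]. *)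
have B_dist e u w : B e u -> B e w -> `|u - w| ^+ 2 <= 8 * e.
  move=> [fu Fu] [fw Fw].
  have h01 : 0 <= (1 / 2 : R) <= 1 by lra.
  have [fz le_fz] := edom_convex pf cf fu fw h01.
  have := mF _ fz; rewrite /F; move: Fu Fw; rewrite /F.
  have -> : (1 / 2) *: u + (1 - 1 / 2) *: w - v =
      (1 / 2) *: ((u - v) + (w - v)).
    have -> : 1 - 1 / 2 = 1 / 2 :> R by lra.
    rewrite -scalerDr addrACA [RHS]scalerDr; congr (_ + _).
    rewrite -opprD scalerN -[v + v]mulr2n -[v *+ 2]scaler_nat scalerA.
    by rewrite mul1r mulVf ?scale1r// pnatr_eq0.
  rewrite normrZ exprMn; have := parallelogram (u - v) (w - v).
  rewrite (_ : u - v - (w - v) = u - w); last by rewrite opprB addrA subrK.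
  rewrite ger0_norm; last by lra.
  move: le_fz; set z := fine (f (_ + _)); nra.
pose FF := filter_from [set e : R | 0 < e] B.
have FFB e : 0 < e -> FF (B e) by move=> e0; exists e.
have FF_proper : ProperFilter FF.
  apply: filter_from_proper; last by move=> e /B0.
  apply: filter_from_filter; first by exists 1 => /=; rewrite ltr01.
  move=> i j /= i0 j0; exists (Num.min i j); first by rewrite lt_min i0.
  by move=> u [fu Fu]; split; split=> //;
    apply: lt_le_trans Fu _; rewrite lerD2l ge_min lexx ?orbT.
have cauchyF : cauchy FF.
  apply/cauchy_exP => e e0.
  have e1 : 0 < e ^+ 2 / 16 by rewrite divr_gt0// exprn_gt0.
  have [u Bu] := B0 _ e1; exists u; apply: filterS (FFB _ e1) => w Bw.
  rewrite -ball_normE /ball_/= -ltr_sqr ?nnegrE ?(ltW e0)//.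
  apply: le_lt_trans (B_dist _ _ _ Bu Bw) _.
  have := exprn_gt0 2 e0; lra.
have /cvg_ex[p FFp] := (@cauchy_cvg V FF FF_proper cauchyF).
have fp : (f p <= (m - 1 / 2 * `|p - v| ^+ 2)%:E)%E.
  rewrite leNgt; apply/negP.
  set M := m - _ => Mf.
  (* A real [c] between [M] and [f p] exists even when [f p] is infinite. Near-minimisers close to
     [p] then force [c - M] to be less than half of itself. *)
  have [c Mc cf'] : exists2 c, M < c & (c%:E < f p)%E.
    have [fp|nd] := pselect (edom f p); last first.
      rewrite (notin_edom nd).
      by exists (M + 1); rewrite ?ltry// ltrDl.
    move: Mf; rewrite -[ltRHS](proper_fineK pf fp) lte_fin => Mf.
    exists ((M + fine (f p)) / 2); first by lra.
    by rewrite -[ltRHS](proper_fineK pf fp) lte_fin; lra.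
  have [W pW fW] := lf cf'.
  have e0 : 0 < (c - M) / 4 by lra.
  have nc : 1 / 2 * `|w - v| ^+ 2 @[w --> p] --> 1 / 2 * `|p - v| ^+ 2.
    have nv : `|w - v| @[w --> p] --> `|p - v|.
      by apply: cvg_norm; apply: cvgB; [exact: cvg_id|exact: cvg_cst].
    by apply: cvgM; [exact: cvg_cst|exact: (cvgM nv nv)].
  have : FF (B ((c - M) / 4) `&` W `&`
      [set w | 1 / 2 * `|p - v| ^+ 2 - (c - M) / 4 < 1 / 2 * `|w - v| ^+ 2]).
    apply: filterI; first by apply: filterI; [exact: FFB|exact: FFp].
    apply: FFp; apply: (cvgr_gt _ nc); lra.
  move=> /filter_ex[w [[[fw Fw] Ww] /= hw]].
  have := fW w Ww; rewrite -[ltRHS](proper_fineK pf fw) lte_fin => cw.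
  move: Fw hw; rewrite /F /M in e0 cw *; lra.
exists p => u /=.
have [fu|nd] := pselect (edom f u); last first.
  by rewrite (notin_edom nd) addye// leey.
have dp : edom f p by exact: le_lt_trans fp (ltry _).
move: fp; rewrite -(proper_fineK pf fu) -(proper_fineK pf dp) -!EFinD !lee_fin.
by have := mF _ fu; rewrite /F; lra.
Qed.

(** Minimality of [p = prox f v] against [t *: u + (1 - t) *: p], divided by [t], gives the
    inequality up to an error [t * |u - p|^2 / 2], removed by letting [t] tend to 0. *)
Lemma proxP v : edom f (prox f v) /\ forall u, edom f u ->
  inner (v - prox f v) (u - prox f v) <= fine (f u) - fine (f (prox f v)).
Proof.
have [q argmin_q] := prox_argmin_neq0 v.
have := @getI _ _ q argmin_q; rewrite -/(prox f v).
move: (prox f v) => p {q argmin_q} min_p.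
have fp : edom f p.
  have [_ [u fu]] := pf; have := min_p u; rewrite /edom/= -(proper_fineK pf fu).
  by rewrite -EFinD; case: (f p) => // r _; rewrite ltry.
split=> // u fu.
set A := fine (f u) - fine (f p) - inner (v - p) (u - p).
suff : 0 <= A by rewrite /A; lra.
have le_A t : 0 < t -> t <= 1 -> 0 <= A + t * (1 / 2 * `|u - p| ^+ 2).
  move=> t0 t1; have t01 : 0 <= t <= 1 by rewrite ltW.
  have [fw le_fw] := edom_convex pf cf fu fp t01.
  have := min_p (t *: u + (1 - t) *: p).
  rewrite -(proper_fineK pf fp) -(proper_fineK pf fw) -!EFinD lee_fin.
  have -> : t *: u + (1 - t) *: p - v = t *: (u - p) - (v - p).
    rewrite scalerBl scale1r scalerBr opprB !addrA; congr (_ + _).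
    by rewrite addrAC.
  rewrite (distrC p v) (sqr_normB (t *: (u - p))) normrZ exprMn innerZl.
  rewrite (innerC (u - p)) (real_normK (num_real t)) => le_t.
  suff : 0 <= t * (A + t * (1 / 2 * `|u - p| ^+ 2)) by rewrite pmulr_rge0.
  rewrite /A; move: le_fw le_t; set z := fine (f (_ + _)).
  move: (inner _ _) (`|_| ^+ 2) (`|_| ^+ 2) (fine _) (fine _) => i a b c e; nra.
apply/ler_addgt0Pr => e e0.
set b := 1 / 2 * `|u - p| ^+ 2 in le_A.
have b0 : 0 <= b by rewrite mulr_ge0.
(* This [t] makes the error at most [e]; the added 1 covers [b = 0]. *)
have := le_A (Num.min 1 (e / (b + 1))).
have b1 : 0 < b + 1 by lra.
rewrite lt_min ltr01 divr_gt0// ge_min lexx => /(_ isT isT).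
have : Num.min 1 (e / (b + 1)) * b <= e.
  apply: le_trans (_ : e / (b + 1) * b <= e).
    by rewrite ler_wpM2r// ge_min lexx orbT.
  by rewrite mulrAC ler_pdivrMr// ler_pM2l// lerDl.
lra.
Qed.

End prox_existence.

(** * Riesz representation and gradients *)

Lemma riesz (R : realType) (V : hilbertType R) (L : V -> R^o) :
  linear L -> continuous L -> exists p, forall h, L h = inner p h.
Proof.
move=> linL cL.
have LD u v : L (u + v) = L u + L v by rewrite -[u in LHS]scale1r linL scale1r.
have L0 : L 0 = 0 by apply: (addrI (L 0)); rewrite -LD !addr0.
have LZ a u : L (a *: u) = a * L u by rewrite -[a *: u]addr0 linL L0 addr0.
(* The prox inequality of [- L] at 0, tested at [p + h], reads [L h <= inner p h]; replacing [h] by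
   [- h] turns it into an equality. *)
pose f u := (- L u)%:E.
have pf : proper f by split=> //; exists 0; rewrite /edom/= ltry.
have cf : econvex f.
  by move=> u v t _; rewrite /f linL LZ -!EFinM -EFinD lee_fin opprD !mulrN.
have lf : lower_semicontinuous f.
  move=> u a; rewrite lte_fin ltrNr => Lu.
  exists [set w | L w < - a]; last by move=> w /=; rewrite lte_fin ltrNr.
  exact: (cvgr_lt _ (cL u)).
have [_ prox_le] := proxP pf cf lf 0; set p := prox f 0 in prox_le.
have leL h : L h <= inner p h.
  have := prox_le (p + h); rewrite /edom/= ltry addrAC subrr add0r => /(_ isT).
  by rewrite innerNl LD; lra.
exists p => h; apply/eqP; rewrite eq_le leL/=.
by have := leL (- h); rewrite innerNr -scaleN1r LZ mulN1r lerN2.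
Qed.

Section gradient.
Context {R : realType} {V : hilbertType R}.
Variables (f : V -> R^o) (y : V).
Hypothesis df : differentiable f y.

Lemma gradientE h : 'd f y h = inner (gradient f y) h.
Proof.
have [||p dfp] := @riesz R V ('d f y).
- by move=> a u v; rewrite linearP.
- exact: diff_continuous.
exact: (@getI _ [set v | forall h, 'd f y h = inner v h] p).
Qed.

(** Concavity makes each difference quotient with [0 < t <= 1] in the direction [w - y] at least
    [f w - f y], and the bound passes to the right-hand limit. *)
Lemma concave_le_gradient w :
  (forall t, 0 <= t <= 1 ->
    t * f w + (1 - t) * f y <= f (t *: w + (1 - t) *: y)) ->
  f w <= f y + inner (gradient f y) (w - y).
Proof.
move=> concave_f; rewrite -gradientE -deriveE// -lerBlDl.
have dv : derivable f y (w - y) by exact: diff_derivable.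
apply: (cvgr_to_ge (cvg_dnbhs_at_right dv)); near=> t.
have t0 : 0 < t by near: t; exact: nbhs_right_gt.
have t1 : t <= 1 by near: t; exact: nbhs_right_le.
have : t * f w + (1 - t) * f y <= f (t *: w + (1 - t) *: y).
  by apply: concave_f; rewrite ltW.
have -> : (f \o shift y) (t *: (w - y)) = f (t *: w + (1 - t) *: y).
  by rewrite /= scalerBr scalerBl scale1r -addrA (addrC (- _)).
rewrite /GRing.scale/= ler_pdivlMl//; lra.
Unshelve. all: by end_near. Qed.

End gradient.

(** * Ultrafilters and convergence *)

Section ultrafilters.

Lemma fmap_ultra (T U : Type) (f : T -> U) (F : set_system T) :
  UltraFilter F -> UltraFilter (f @ F).
Proof.
move=> FU; split; first exact: fmap_proper_filter.
move=> G GF FG; apply/seteqP; split=> // A GA.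
have [//|FnA] := in_ultra_setVsetC (f @^-1` A) FU.
have : G (A `&` ~` A) by apply: filterI => //; apply: FG.
by rewrite setICr => /filter_not_empty.
Qed.

(** If [f @ F] misses a neighbourhood [A], then [F] restricted to the complement of the preimage of
    [A] is proper, and an ultrafilter above it would contain two disjoint sets. *)
Lemma cvg_ultra (T : Type) (U : topologicalType) (F : set_system T)
    (f : T -> U) (l : U) : Filter F ->
  (forall G, UltraFilter G -> F `<=` G -> f @ G --> l) -> f @ F --> l.
Proof.
move=> FF cvg_f A lA; apply: contrapT => nFA.
have FP : ProperFilter (within (~` (f @^-1` A)) F).
  split; last exact: within_filter.
  rewrite /within/= => F0; apply: nFA; apply: filterS F0 => x /=.
  by move=> ?; apply: contrapT.
have [G [GU FG]] := ultraFilterLemma FP.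
have GnA : G (~` (f @^-1` A)) by apply: FG; rewrite /within/=; apply: filterE.
have GA : G (f @^-1` A).
  by apply: cvg_f lA => B FB; apply: FG; rewrite /within/=; apply: filterS FB.
have : G (f @^-1` A `&` ~` (f @^-1` A)) by exact: filterI.
by rewrite setICr => /filter_not_empty.
Qed.

End ultrafilters.

(** * Weak limits along filters: lower semicontinuity and compactness *)

Section weak_limits.
Context {R : realType} {V : hilbertType R} {T : Type}.
Variable F : set_system T.

Definition inner_cvg (u : T -> V) (p : V) :=
  forall h, inner (u n) h @[n --> F] --> inner p h.

(* The nearest point [q] to [p] in the sublevel set, that is the proximal point
   of its indicator [i], satisfies [inner (p - q) (u n - q) <= 0]; in the limit
   [p = q]. *)
Lemma inner_cvg_sublevel {FF : ProperFilter F} (f : V -> \bar R) u p c :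
  proper f -> econvex f -> lower_semicontinuous f -> inner_cvg u p ->
  (\forall n \near F, f (u n) <= c%:E)%E -> (f p <= c%:E)%E.
Proof.
move=> pf cf lf up fuc.
pose i w : \bar R := if (f w <= c%:E)%E then 0%E else +oo%E.
have iE w : edom i w -> (f w <= c%:E)%E.
  by rewrite /edom/= /i; case: ifP => //; rewrite ltxx.
have i0 w : (f w <= c%:E)%E -> i w = 0%E by rewrite /i => ->.
have pi : proper i.
  split; first by move=> w; rewrite /i; case: ifP.
  by have [n /i0 iu] := filter_ex fuc; exists (u n); rewrite /edom/= iu.
have ci : econvex i.
  move=> v w t t01.
  (* The end points are split off because [0 * +oo = 0]: an infinite value of [i] is felt only with
     a nonzero weight. *)
  have [->|t0] := eqVneq t 0.
    by rewrite scale0r add0r subr0 scale1r mul0e add0e mul1e.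
  have [->|t1] := eqVneq t 1.
    by rewrite subrr scale0r addr0 scale1r mul0e adde0 mul1e.
  have i_ge0 z : (0 <= i z)%E by rewrite /i; case: ifP.
  have iy (s : R) z : 0 <= s <= 1 -> s != 0 -> ~~ (f z <= c%:E)%E ->
      (s%:E * i z = +oo)%E.
    move=> /andP[s0 _] sN0 fz.
    by rewrite /i (negbTE fz) gt0_muley// lte_fin lt_neqAle eq_sym sN0.
  have iNy (s : R) z : 0 <= s <= 1 -> (s%:E * i z != -oo)%E.
    move=> /andP[s0 _]; rewrite -ltNye (lt_le_trans ltNy0)//.
    by rewrite mule_ge0// lee_fin.
  have s01 : 0 <= 1 - t <= 1 by move: t01; lra.
  have [fv|fv] := boolP (f v <= c%:E)%E; last first.
    by rewrite (iy t)// addye ?leey ?iNy.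
  have [fw|fw] := boolP (f w <= c%:E)%E; last first.
    by rewrite (iy (1 - t)) ?addey ?leey ?iNy// subr_eq0 eq_sym.
  rewrite (i0 _ fv) (i0 _ fw) !mule0 adde0 i0//.
  have dv : edom f v by exact: le_lt_trans fv (ltry _).
  have dw : edom f w by exact: le_lt_trans fw (ltry _).
  have [dz le_fz] := edom_convex pf cf dv dw t01.
  move: fv fw; rewrite -(proper_fineK pf dz) -(proper_fineK pf dv).
  by rewrite -(proper_fineK pf dw) !lee_fin; case/andP: t01; nra.
have li : lower_semicontinuous i.
  move=> v a; rewrite {1}/i; case: ifPn => [_ a0|].
    exists setT => [|w _]; first exact: filterT.
    by apply: lt_le_trans a0 _; rewrite /i; case: ifP.
  rewrite -ltNge => cv _; have [W vW fW] := lf _ _ cv.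
  by exists W => // w /fW; rewrite ltNge /i => /negbTE ->; rewrite ltry.
have [iq prox_le] := proxP pi ci li p; set q := prox i p in iq prox_le.
suff -> : p = q by exact: iE.
apply/subr0_eq/eqP; rewrite -normr_eq0 -sqrf_eq0 eq_le sqr_ge0 andbT.
rewrite -inner_norm.
have : inner (u n - q) (p - q) @[n --> F] --> inner (p - q) (p - q).
  rewrite !innerDl; under eq_fun do rewrite innerDl.
  by apply: cvgD; [exact: up|exact: cvg_cst].
move=> /cvgr_to_le; apply; apply: filterS fuc => n fun_c.
have := prox_le (u n).
rewrite (i0 _ (iE _ iq)) (i0 _ fun_c) subrr innerC; apply.
by rewrite /edom/= i0.
Qed.

(** An ultrafilter contains a set or its complement, so if the claim failed, [u] would eventually
    lie in a sublevel set, and [inner_cvg_sublevel] would contradict [c%:E < f p]. *)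
Lemma inner_cvg_lsc {FF : UltraFilter F} (f : V -> \bar R) u p c :
  proper f -> econvex f -> lower_semicontinuous f -> inner_cvg u p ->
  (c%:E < f p -> \forall n \near F, c%:E < f (u n))%E.
Proof.
move=> pf cf lf up cfp.
have [//|Fn] := in_ultra_setVsetC [set n | c%:E < f (u n)]%E FF.
suff : (f p <= c%:E)%E by rewrite leNgt cfp.
apply: (inner_cvg_sublevel pf cf lf up); apply: filterS Fn => n /= /negP.
by rewrite leNgt.
Qed.

(** Each [inner (u n) h] stays in a compact segment, so a single ultrafilter gives limits for all
    [h] at once, without extracting subsequences. The limit is linear and bounded in [h], hence
    represented by a vector. *)
Lemma bounded_inner_cvg {FF : UltraFilter F} (u : T -> V) M :
  (forall n, `|u n| <= M) -> exists p, inner_cvg u p.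
Proof.
move=> uM.
have cvg_u h : exists l : R, `|l| <= M * `|h| /\ inner (u n) h @[n --> F] --> l.
  have := @segment_compact R (- (M * `|h|)) (M * `|h|).
  rewrite compact_ultra => /(_ _ (fmap_ultra (fun n => inner (u n) h) FF)).
  case.
    apply: (@filterE T F) => n /=; rewrite in_itv/= -ler_norml.
    by apply: le_trans (CauchySchwarz_inner _ _) _; exact: ler_wpM2r.
  by move=> l [/=]; rewrite in_itv/= -ler_norml => lM ul; exists l.
have [L uL] := choice cvg_u.
have linL a v w : L (a *: v + w) = a * L v + L w.
  have := (uL (a *: v + w)).2.
  under eq_fun do rewrite innerDr innerZr.
  move=> /cvg_lim <-//; apply/cvg_lim => //.
  apply: cvgD; last exact: (uL w).2.
  by apply: cvgM; [exact: cvg_cst|exact: (uL v).2].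
have LB v w : L (v - w) = L v - L w.
  by rewrite addrC -scaleN1r linL mulN1r addrC.
have [||p Lp] := @riesz R V L.
- exact: linL.
- move=> h; apply/cvgrPdist_le => e e0; near=> w.
  have LM : `|L h - L w| <= M * `|h - w| by rewrite -LB; exact: (uL _).1.
  apply: (le_trans LM).
  have M1 : 0 < `|M| + 1 by rewrite ltr_wpDl.
  have : `|h - w| <= e / (`|M| + 1).
    near: w; apply: cvgr_dist_le; first exact: cvg_id.
    by rewrite divr_gt0.
  rewrite ler_pdivlMr//; apply: le_trans.
  by rewrite mulrC ler_wpM2l// ler_wpDr// ler_norm.
by exists p => h; rewrite -Lp; exact: (uL h).2.
Unshelve. all: by end_near. Qed.

End weak_limits.

(** * Finite values of the objective and characterisation of saddle points *)

Section minimax_facts.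
Context {R : realType} {H G : hilbertType R}.
Variables (Phi : H -> G -> \bar R) (g : G -> \bar R) (Lyx Lyy : R).
Hypothesis sa : standing_assumptions Phi g 0 Lyx Lyy.

Let P := dom_fst Phi.
Let phi u v := fine (Phi u v).
Let gam v := fine (g v).
Let psi u v := phi u v - gam v.

Lemma dom_fst_fineK u v : P u -> (phi u v)%:E = Phi u v.
Proof.
move=> Pu; rewrite fineK// fin_numE (Phi_Nninfty sa)/= -ltey.
by have : edom (Phi u) v by rewrite (Phi_snd_dom sa Pu).
Qed.

Lemma edom_dom_fst u v : P u -> edom (Phi^~ v) u.
Proof. by move=> Pu; rewrite /edom/= -dom_fst_fineK// ltry. Qed.

Lemma g_econvex : econvex g.
Proof.
have := g_convex sa; rewrite /convex_modulus.
by under eq_fun do rewrite mul0r mul0r sube0.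
Qed.

Lemma gK v : edom g v -> (gam v)%:E = g v.
Proof. by move=> gv; rewrite (proper_fineK (g_proper sa) gv). Qed.

Lemma PsiE u v : P u -> edom g v -> Psi Phi g u v = (psi u v)%:E.
Proof.
by move=> Pu gv; rewrite /Psi -(dom_fst_fineK v Pu)/= -(gK gv).
Qed.

Lemma Psi_pinfty u v : ~ P u -> Psi Phi g u v = +oo%E.
Proof.
move=> Pu; rewrite /Psi; case: eqP => // /eqP Puv; exfalso; apply: Pu.
by exists v; rewrite ltey.
Qed.

Lemma Psi_ninfty u v : P u -> ~ edom g v -> Psi Phi g u v = -oo%E.
Proof.
by move=> Pu gv; rewrite /Psi -(dom_fst_fineK v Pu)/= (notin_edom gv).
Qed.

(** If [xs] were outside [P], the value [+oo] of [Psi xs ys] would be at most [Psi u0 ys], which is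
    below [+oo]. If [ys] were outside [edom g], the value [-oo] would be at least the finite
    [Psi xs w0]. *)
Lemma saddle_dom xs ys : saddle_point Phi g xs ys -> P xs /\ edom g ys.
Proof.
move=> sad; have [u0 [v0 Puv]] := Phi_dom sa.
have Pu0 : P u0 by exists v0.
have [_ [w0 gw0]] := g_proper sa.
have Pxs : P xs.
  apply: contrapT => nP; have := (sad u0 w0).2; rewrite (Psi_pinfty ys nP).
  have [gys|gys] := pselect (edom g ys); first by rewrite PsiE.
  by rewrite Psi_ninfty.
split=> //; apply: contrapT => ngys.
by have := (sad u0 w0).1; rewrite (Psi_ninfty Pxs ngys) PsiE.
Qed.

Lemma saddle_le xs ys u v : saddle_point Phi g xs ys -> P u -> edom g v ->
  psi xs v <= psi u ys.
Proof.
move=> sad Pu gv; have [Pxs gys] := saddle_dom sad.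
have [] := sad u v; rewrite !PsiE// !lee_fin; exact: le_trans.
Qed.

(** The choices [u = xs] and [v = ys] split the single inequality, the form that weak limits
    deliver, into the two halves of the definition. *)
Lemma saddle_intro xs ys : P xs -> edom g ys ->
  (forall u v, P u -> edom g v -> psi xs v <= psi u ys) ->
  saddle_point Phi g xs ys.
Proof.
move=> Pxs gys le_psi u v; split.
  have [gv|gv] := pselect (edom g v); last by rewrite (Psi_ninfty Pxs gv) leNye.
  by rewrite !PsiE// lee_fin le_psi.
have [Pu|Pu] := pselect (P u); last by rewrite (Psi_pinfty _ Pu) leey.
by rewrite !PsiE// lee_fin le_psi.
Qed.

Lemma NPhi_proper u : P u -> proper (fun v => - Phi u v)%E.
Proof.
move=> Pu; split; first by move=> v; rewrite -dom_fst_fineK.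
by exists 0; rewrite /edom/= -dom_fst_fineK// ltry.
Qed.

Lemma fine_NPhi u v : fine (- Phi u v)%E = - phi u v.
Proof. by rewrite /phi; case: (Phi u v) => //=; rewrite oppr0. Qed.

Lemma edom_NPhi u v : P u -> edom (fun v => - Phi u v)%E v.
Proof. by move=> Pu; rewrite /edom/= -dom_fst_fineK// ltry. Qed.

(** Continuity comes from differentiability; with concavity it later makes [Phi u] weakly upper
    semicontinuous. *)
Lemma NPhi_lsc u : P u -> lower_semicontinuous (fun v => - Phi u v)%E.
Proof.
move=> Pu v a; rewrite -dom_fst_fineK// lte_fin ltrNr => av.
exists [set w | phi u w < - a].
  have := differentiable_continuous (Phi_snd_diff sa Pu v).
  by move=> /cvgr_lt; exact.
by move=> w /=; rewrite -dom_fst_fineK// lte_fin ltrNr.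
Qed.

Lemma phi_le_gradient u v w : P u ->
  phi u w <= phi u v + inner (grad_y Phi u v) (w - v).
Proof.
move=> Pu; apply: (concave_le_gradient (Phi_snd_diff sa Pu v)) => t t01 /=.
have [_] := edom_convex (NPhi_proper Pu) (Phi_snd_concave sa Pu)
  (edom_NPhi w Pu) (edom_NPhi v Pu) t01.
by rewrite !fine_NPhi /phi; lra.
Qed.

End minimax_facts.

(** * Jensen's inequality for ergodic means, and limit tools *)

Lemma ergodic_mean_convex (R : realType) (V : lmodType R) (f : V -> \bar R)
    (z : nat -> V) (K : nat) : proper f -> econvex f ->
  (forall k, edom f (z k.+1)) -> (0 < K)%N ->
  edom f (ergodic_mean z K) /\
  K%:R * fine (f (ergodic_mean z K)) <= \sum_(0 <= k < K) fine (f (z k.+1)).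
Proof.
move=> pf cf fz; elim: K => // -[_ _|K IH _].
  by rewrite /ergodic_mean !big_nat1 invr1 scale1r mul1r.
have [fK le_fK] := IH isT.
(* The mean of [K.+2] terms is the mean of the first [K.+1] with weight [t] plus the last term with
   weight [1 - t]. *)
pose t : R := K.+1%:R / K.+2%:R.
have K2 : 0 < K.+2%:R :> R by rewrite ltr0n.
have tK : t * K.+2%:R = K.+1%:R by rewrite /t divfK// gt_eqF.
have K21 : K.+2%:R = K.+1%:R + 1 :> R by rewrite -natr1.
have t1 : 1 - t = K.+2%:R^-1.
  have -> : t = (K.+2%:R - 1) / K.+2%:R by rewrite /t K21 addrK.
  by rewrite mulrBl divff ?gt_eqF// mul1r opprB addrCA subrr addr0.
have -> : ergodic_mean z K.+2 = t *: ergodic_mean z K.+1 + (1 - t) *: z K.+2.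
  rewrite /ergodic_mean [in LHS]big_nat_recr//= scalerDr t1 scalerA.
  congr (_ *: _ + _).
  by rewrite /t mulrAC divff ?mul1r// pnatr_eq0.
have t01 : 0 <= t <= 1.
  by apply/andP; split; rewrite ?divr_ge0// -subr_ge0 t1 invr_ge0.
have [fK2 le_fK2] := edom_convex pf cf fK (fz K.+1) t01; split=> //.
rewrite big_nat_recr//=; set S := \sum_(_ <= _ < _) _ in le_fK *.
apply: le_trans (ler_wpM2l (ltW K2) le_fK2) _.
rewrite mulrDr (mulrA _ t) (mulrC _ t) tK (mulrA _ (1 - t)) t1.
rewrite divff ?gt_eqF// mul1r.
by rewrite lerD2r.
Qed.

Section convergence_tools.
Context {R : realType}.

Lemma le_EFin_of_lt (A : \bar R) M :
  (forall c, (c%:E < A)%E -> c <= M) -> (A <= M%:E)%E.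
Proof.
case: A => [r| |] ltA; last by rewrite leNye.
- rewrite lee_fin leNgt; apply/negP => Mr.
  have : (((M + r) / 2)%:E < r%:E)%E by rewrite lte_fin; lra.
  by move=> /ltA; lra.
- by exfalso; have := ltA (M + 1) (ltry _); lra.
Qed.

Lemma exists_lt_EFin (A : \bar R) : A != -oo%E -> exists c, (c%:E < A)%E.
Proof.
case: A => [r| |] // _; first by exists (r - 1); rewrite lte_fin; lra.
by exists 0; rewrite ltry.
Qed.

(** Reals below [A1], [A2], [A3] are eventually below [s1], [s2], [s3], so their sums stay below
    [C]; taking suprema one at a time forces finiteness. The finiteness is what will place weak
    limits in the domains. *)
Lemma near_sum3_le (T : Type) (F : set_system T) {FF : ProperFilter F}
    (A1 A2 A3 : \bar R) (s1 s2 s3 : T -> R) C :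
  A1 != -oo%E -> A2 != -oo%E -> A3 != -oo%E ->
  (forall c, (c%:E < A1)%E -> \forall n \near F, c < s1 n) ->
  (forall c, (c%:E < A2)%E -> \forall n \near F, c < s2 n) ->
  (forall c, (c%:E < A3)%E -> \forall n \near F, c < s3 n) ->
  (\forall n \near F, s1 n + s2 n + s3 n <= C) ->
  [/\ (A1 < +oo)%E, (A2 < +oo)%E & fine A1 + fine A2 + fine A3 <= C].
Proof.
move=> N1 N2 N3 l1 l2 l3 le_C.
have key c1 c2 c3 : (c1%:E < A1)%E -> (c2%:E < A2)%E -> (c3%:E < A3)%E ->
    c1 + c2 + c3 <= C.
  move=> /l1 h1 /l2 h2 /l3 h3.
  near F => n; apply: (@le_trans _ _ (s1 n + s2 n + s3 n)); last by near: n.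
  by rewrite !lerD// ltW//; near: n.
have [m1 h1] := exists_lt_EFin N1; have [m2 h2] := exists_lt_EFin N2.
have le3 c1 c2 : (c1%:E < A1)%E -> (c2%:E < A2)%E ->
    (A3 <= (C - c1 - c2)%:E)%E.
  by move=> h1' h2'; apply: le_EFin_of_lt => c /(key _ _ _ h1' h2'); lra.
have := le3 _ _ h1 h2; move: N3 le3; case: A3 {l3} key => [r3| |] // _ _ le3 _.
have le2 c1 : (c1%:E < A1)%E -> (A2 <= (C - c1 - r3)%:E)%E.
  move=> h1'; apply: le_EFin_of_lt => c h2'.
  by have := le3 _ _ h1' h2'; rewrite lee_fin; lra.
have := le2 _ h1; move: N2 le2; case: A2 {l2 h2} le3 => [r2| |] // _ _ le2 _.
have : (A1 <= (C - r2 - r3)%:E)%E.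
  by apply: le_EFin_of_lt => c /le2; rewrite lee_fin; lra.
move: N1; case: A1 {l1 h1 le2} => [r1| |] // _; rewrite lee_fin => le1.
by split; rewrite ?ltry//=; lra.
Unshelve. all: by end_near. Qed.

Lemma cvg0_le (f h : nat -> R) : (forall n, `|f n| <= h n) ->
  h n @[n --> \oo] --> 0 -> f n @[n --> \oo] --> 0.
Proof.
move=> fh h0; apply/norm_cvg0P.
apply: (squeeze_cvgr _ (cvg_cst 0) h0).
by apply: nearW => n; rewrite normr_ge0 fh.
Qed.

Lemma cvg0D (f h : nat -> R) : f n @[n --> \oo] --> 0 ->
  h n @[n --> \oo] --> 0 -> f n + h n @[n --> \oo] --> 0.
Proof. by move=> f0 h0; rewrite -[X in _ --> X]addr0; exact: cvgD. Qed.

Lemma cvg0Ml (f : nat -> R) C :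
  f n @[n --> \oo] --> 0 -> C * f n @[n --> \oo] --> 0.
Proof.
move=> f0; rewrite -[X in _ --> X](mulr0 C).
by apply: cvgM => //; exact: cvg_cst.
Qed.

Lemma cvg0_exp2 (f : nat -> R) :
  f n @[n --> \oo] --> 0 -> f n ^+ 2 @[n --> \oo] --> 0.
Proof. by move=> f0; rewrite -(mul0r 0); exact: (cvgM f0 f0). Qed.

Lemma cvg0_sqr (f : nat -> R) : (forall n, 0 <= f n) ->
  f n ^+ 2 @[n --> \oo] --> 0 -> f n @[n --> \oo] --> 0.
Proof.
move=> f0 /cvgrPdist_lt ff; apply/cvgrPdist_lt => e e0.
have := ff (e ^+ 2) (exprn_gt0 2 e0); apply: filterS => n.
rewrite !sub0r !normrN !ger0_norm ?exprn_ge0//.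
by rewrite ltr_sqr ?nnegrE// ltW.
Qed.

Lemma inner_cvg0 (V : hilbertType R) (w z : nat -> V) M :
  `|w n| @[n --> \oo] --> 0 -> (forall n, `|z n| <= M) ->
  inner (w n) (z n) @[n --> \oo] --> 0.
Proof.
move=> w0 zM; apply: (@cvg0_le _ (fun n => `|w n| * M)).
  by move=> n; apply: le_trans (CauchySchwarz_inner _ _) _; rewrite ler_wpM2l.
by rewrite -[X in _ --> X](mul0r M); apply: cvgM => //; exact: cvg_cst.
Qed.

(** An ultrafilter need not be invariant under the index shift, so the shifted sequence gets its
    limit from the vanishing steps. *)
Lemma inner_cvg_shift (V : hilbertType R) (F : set_system nat) {FF : Filter F}
    (z : nat -> V) p :
  \oo `<=` F -> `|z n.+1 - z n| @[n --> \oo] --> 0 ->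
  inner_cvg F z p -> inner_cvg F (fun n => z n.+1) p.
Proof.
move=> ooF dz zp h.
have -> : (fun n => inner (z n.+1) h) =
    (fun n => inner (z n) h + inner (z n.+1 - z n) h).
  by apply/funext => n; rewrite -innerDl addrC subrK.
rewrite -[inner p h]addr0; apply: cvgD; first exact: zp.
apply: cvg_trans (inner_cvg0 dz (fun=> lexx `|h|)).
by move=> A; exact: ooF.
Qed.

End convergence_tools.

(** * The iteration: one-step inequality, energy descent and ergodic rate *)

Section iteration.
Context {R : realType} {H G : hilbertType R}.
Variables (Phi : H -> G -> \bar R) (g : G -> \bar R) (Lyx Lyy c tau sigma : R).
Variables (x : nat -> H) (y : nat -> G).
Hypothesis sa : standing_assumptions Phi g 0 Lyx Lyy.
Hypothesis Lyx_lt_c : Lyx < c.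
Hypothesis tau_gt0 : 0 < tau.
Hypothesis sigma_gt0 : 0 < sigma.
Hypothesis step_size : (c * Lyx * tau + 2 * Lyy) * sigma < 1.
Hypothesis alg : OGAProx Phi g (fun=> tau) (fun=> sigma) (fun=> 1) x y.

(* The gradients are kept abstract: unfolding [grad_y] during unification is
   expensive. *)
Variable d : nat -> G.
Hypothesis dE : forall k, d k = grad_y Phi (x k) (y k).

Local Notation P := (dom_fst Phi).
Local Notation phi u v := (fine (Phi u v)).
Local Notation gam v := (fine (g v)).
Local Notation psi u v := (phi u v - gam v).
(** At [k = 0] the truncated predecessor makes [q], [a] and [b] vanish, so the initial energy
    consists of squared distances only. *)
Let q k := d k - d k.-1.
Let a k := `|x k - x k.-1|.
Let b k := `|y k - y k.-1|.
(** [Lyx < c] becomes [kappa < 1], and [2 * sigma * delta] is the slack in the step size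
    condition. *)
Let kappa := Lyx / c.
Let delta := 1 / (2 * sigma) - c * Lyx * tau / 2 - Lyy.

Let prox_y k : edom g (y k.+1) /\ forall v, edom g v ->
  inner (y k - y k.+1) (v - y k.+1) / sigma
    + inner (d k + q k) (v - y k.+1) <= gam v - gam (y k.+1).
Proof.
have [gP gC gL] := And3 (g_proper sa) (g_econvex sa) (g_lsc sa).
have := proxP (properZ sigma_gt0 gP) (econvexZ sigma_gt0 gP gC)
  (lower_semicontinuousZ sigma_gt0 gL)
  (y k + sigma *: ((1 + 1) *: d k - 1 *: d k.-1)).
rewrite edomZ// !dE -(OGAProx_y alg) -!dE => -[gy le_prox]; split=> // v gv.
have := le_prox v gv; rewrite -(gK sa gv) -(gK sa gy) -!EFinM/=.
(* For [theta = 1] the extrapolated gradient is [d k + q k]. *)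
have -> : y k + sigma *: ((1 + 1) *: d k - 1 *: d k.-1) - y k.+1 =
    y k - y k.+1 + sigma *: (d k + q k).
  by rewrite addrAC scalerDl !scale1r -[d k + d k - _]addrA /q.
rewrite innerDl innerZl -mulrBr => le_v.
rewrite -(ler_pM2l sigma_gt0) mulrDr mulrCA divff ?gt_eqF// mulr1.
exact: le_v.
Qed.

Let prox_x k : P (x k.+1) /\ forall u, P u ->
  inner (x k - x k.+1) (u - x k.+1) / tau
    <= phi u (y k.+1) - phi (x k.+1) (y k.+1).
Proof.
have gy := (prox_y k).1.
have pP := Phi_fst_proper sa gy.
have := proxP (properZ tau_gt0 pP) (econvexZ tau_gt0 pP (Phi_fst_convex sa gy))
  (lower_semicontinuousZ tau_gt0 (Phi_fst_lsc sa gy)) (x k).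
rewrite edomZ// -(OGAProx_x alg) => -[Px le_prox].
have {}Px : P (x k.+1) by exists (y k.+1).
split=> // u Pu; have := le_prox u (edom_dom_fst sa _ Pu).
rewrite -(dom_fst_fineK sa _ Pu) -(dom_fst_fineK sa _ Px) -!EFinM/= -mulrBr.
by rewrite ler_pdivrMr// mulrC.
Qed.

Lemma iterates_dom k : P (x k) /\ edom g (y k).
Proof.
case: k => [|k]; first by split; [exact: OGAProx_x0 alg|exact: OGAProx_y0 alg].
by split; [exact: (prox_x k).1|exact: (prox_y k).1].
Qed.

Lemma norm_q_le k : `|q k| <= Lyx * a k + Lyy * b k.
Proof.
have [Px gy] := iterates_dom k; have [Px' gy'] := iterates_dom k.-1.
rewrite /q !dE; exact: (grad_y_lipschitz sa Px Px' gy gy').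
Qed.

(** Sum of the two prox inequalities and of concavity of [Phi (x k.+1)] at [y k.+1]. The gradient
    error [d k.+1 - (d k + q k)] equals [q k.+1 - q k]: this is what the extrapolation buys. *)
Lemma step_le k u v : P u -> edom g v ->
  psi (x k.+1) v - psi u (y k.+1) <=
    inner (q k.+1 - q k) (v - y k.+1)
    - inner (x k - x k.+1) (u - x k.+1) / tau
    - inner (y k - y k.+1) (v - y k.+1) / sigma.
Proof.
move=> Pu gv.
have conc : phi (x k.+1) v <=
    phi (x k.+1) (y k.+1) + inner (d k.+1) (v - y k.+1).
  by rewrite dE; exact: (phi_le_gradient sa _ _ (prox_x k).1).
have -> : inner (q k.+1 - q k) (v - y k.+1) =
    inner (d k.+1) (v - y k.+1) - inner (d k + q k) (v - y k.+1).
  have -> : q k.+1 - q k = d k.+1 - (d k + q k).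
    by rewrite [in RHS]opprD [RHS]addrA.
  by rewrite innerDl innerNl.
move: conc ((prox_x k).2 u Pu) ((prox_y k).2 v gv).
move: (inner _ _) (inner _ _) (inner _ _ / sigma) (inner _ _ / tau).
move: (phi _ _) (phi _ _) (phi _ _) (gam _) (gam _) => *; lra.
Qed.

(** The inner product is the telescoping part of the gradient error; the last two terms are those
    that [q_inner_le] charges to the previous step. *)
Definition energy u v k :=
  1 / (2 * tau) * `|u - x k| ^+ 2 + 1 / (2 * sigma) * `|v - y k| ^+ 2
  - inner (q k) (v - y k)
  + kappa / (2 * tau) * a k ^+ 2 + Lyy / 2 * b k ^+ 2.

Let c_gt0 : 0 < c. Proof. exact: le_lt_trans (Lyx_ge0 sa) Lyx_lt_c. Qed.

Let kappa_ge0 : 0 <= kappa.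
Proof. by rewrite divr_ge0 ?(ltW c_gt0)// (Lyx_ge0 sa). Qed.

Let kappa_lt1 : kappa < 1.
Proof. by rewrite ltr_pdivrMr// mul1r. Qed.

Let delta_gt0 : 0 < delta.
Proof.
suff : 0 < delta * (2 * sigma) by rewrite pmulr_lgt0// mulr_gt0.
rewrite /delta !mulrBl mul1r mulVf ?mulf_neq0 ?pnatr_eq0 ?gt_eqF//.
by move: step_size; lra.
Qed.

(* Young's inequality with the weight for which [kappa * c = Lyx]. *)
Lemma q_inner_le k w : inner (q k) w <=
  kappa / (2 * tau) * a k ^+ 2 + Lyy / 2 * b k ^+ 2
  + (c * Lyx * tau / 2 + Lyy / 2) * `|w| ^+ 2.
Proof.
apply: le_trans (ler_inner _ _) _.
apply: le_trans (ler_wpM2r (normr_ge0 w) (norm_q_le k)) _.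
have LyxE : Lyx = kappa * c by rewrite /kappa divfK// gt_eqF.
have : 0 <= kappa / (2 * tau) * (a k - c * tau * `|w|) ^+ 2.
  by rewrite mulr_ge0 ?sqr_ge0// divr_ge0// mulr_ge0// ltW.
have : 0 <= Lyy / 2 * (b k - `|w|) ^+ 2.
  by rewrite mulr_ge0 ?sqr_ge0// divr_ge0// (Lyy_ge0 sa).
have -> : kappa / (2 * tau) * (a k - c * tau * `|w|) ^+ 2 =
    kappa / (2 * tau) * a k ^+ 2 - Lyx * a k * `|w|
    + c * Lyx * tau / 2 * `|w| ^+ 2.
  by rewrite LyxE; field; rewrite gt_eqF.
lra.
Qed.

Lemma energy_descent u v k : P u -> edom g v ->
  psi (x k.+1) v - psi u (y k.+1) <= energy u v k - energy u v k.+1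
    - (1 - kappa) / (2 * tau) * a k.+1 ^+ 2 - delta * b k.+1 ^+ 2.
Proof.
move=> Pu gv; apply: le_trans (step_le k Pu gv) _.
have := q_inner_le k (y k.+1 - y k).
(* Only [inner (q k) (y k.+1 - y k)] fails to telescope. [q_inner_le] bounds it, and its coefficient
   of [b k.+1 ^+ 2] is absorbed by [1 / (2 * sigma)], leaving [delta]. *)
have shift (q1 q0 y1 y0 : G) : inner (q1 - q0) (v - y1) =
    inner q1 (v - y1) - inner q0 (v - y0) + inner q0 (y1 - y0).
  by rewrite !innerE; ring.
rewrite (shift _ _ _ (y k)).
have half (z r : R) : z / r = 1 / (2 * r) * (2 * z).
  by rewrite invfM; move: r^-1 => i; field.
rewrite (half _ tau) (half _ sigma) !three_point (distrC (x k)) (distrC (y k)).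
rewrite /energy /delta /a /b/=.
have -> : (1 - kappa) / (2 * tau) = 1 / (2 * tau) - kappa / (2 * tau).
  by rewrite mulrBl.
move: (inner (q k) (y k.+1 - y k)) (inner (q k) (v - y k)).
move: (inner (q k.+1) (v - y k.+1)) => i1 i2 i3; move: kappa => K.
move: `|y k.+1 - y k| `|x k.+1 - x k| `|u - x k.+1| `|v - y k.+1| => *.
lra.
Qed.

(** In [q_inner_le] with [w = v - y k] the [a] and [b] terms cancel those of the energy, and the
    coefficient left on [|v - y k|^2] is [delta + Lyy / 2]. *)
Lemma energy_ge u v k :
  1 / (2 * tau) * `|u - x k| ^+ 2 + delta * `|v - y k| ^+ 2 <= energy u v k.
Proof.
have := q_inner_le k (v - y k); rewrite /energy /delta.
have : 0 <= Lyy / 2 * `|v - y k| ^+ 2.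
  by rewrite mulr_ge0 ?sqr_ge0// divr_ge0// (Lyy_ge0 sa).
lra.
Qed.

Lemma energy0 u v : energy u v 0 =
  1 / (2 * tau) * `|u - x 0%N| ^+ 2 + 1 / (2 * sigma) * `|v - y 0%N| ^+ 2.
Proof.
rewrite /energy /a /b /q/= !subrr !normr0 inner0l expr0n/=.
by rewrite !mulr0 subr0 !addr0.
Qed.

Let delta_ge0 := ltW delta_gt0.

Lemma gap_sum_le u v K : P u -> edom g v ->
  \sum_(0 <= k < K) (psi (x k.+1) v - psi u (y k.+1)) <= energy u v 0.
Proof.
move=> Pu gv; suff : \sum_(0 <= k < K) (psi (x k.+1) v - psi u (y k.+1))
    <= energy u v 0 - energy u v K.
  move=> /le_trans; apply; rewrite lerBlDr lerDl.
  apply: le_trans (energy_ge u v K); rewrite addr_ge0// mulr_ge0 ?sqr_ge0//.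
  by rewrite divr_ge0// mulr_ge0// ltW.
elim: K => [|K IH]; first by rewrite big_geq// subrr.
rewrite big_nat_recr//=; have := energy_descent K Pu gv.
have : 0 <= (1 - kappa) / (2 * tau) * a K.+1 ^+ 2.
  rewrite mulr_ge0 ?sqr_ge0// divr_ge0 ?subr_ge0 ?(ltW kappa_lt1)//.
  by rewrite mulr_ge0// ltW.
have : 0 <= delta * b K.+1 ^+ 2 by rewrite mulr_ge0 ?sqr_ge0.
by move: IH; lra.
Qed.

(** Jensen's inequality for the convex functions [Phi^~ vs], [g] and [- Phi us] bounds [K] times the
    gap of the means by the summed gaps. *)
Lemma ergodic_gap K us vs : (0 < K)%N -> saddle_point Phi g us vs ->
  (0 <= Psi Phi g (ergodic_mean x K) vs - Psi Phi g us (ergodic_mean y K)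
     <= (K%:R^-1 * energy us vs 0)%:E)%E.
Proof.
move=> K0 sad; have [Pus gvs] := saddle_dom sa sad.
have Px k := (iterates_dom k).1; have gy k := (iterates_dom k).2.
have [] := ergodic_mean_convex (z := x) (Phi_fst_proper sa gvs)
  (Phi_fst_convex sa gvs) (fun k => edom_dom_fst sa vs (Px k.+1)) K0.
move=> ePx; have {ePx}Pxm : P (ergodic_mean x K) by exists vs.
have [gym] := ergodic_mean_convex (z := y) (g_proper sa) (g_econvex sa)
  (fun k => gy k.+1) K0.
have [_] := ergodic_mean_convex (z := y) (NPhi_proper sa Pus)
  (Phi_snd_concave sa Pus) (fun k => edom_NPhi sa (y k.+1) Pus) K0.
rewrite fine_NPhi; under eq_bigr do rewrite fine_NPhi.
rewrite sumrN => le1 le2 le3.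
rewrite (PsiE sa Pxm gvs) (PsiE sa Pus gym) -EFinB !lee_fin.
rewrite subr_ge0 (saddle_le sa sad Pxm gym)/=.
have K0' : 0 < K%:R :> R by rewrite ltr0n.
rewrite ler_pdivlMl//; apply: le_trans (gap_sum_le K Pus gvs).
move: le1 le2 le3; rewrite !sumrB.
have -> : \sum_(0 <= k < K) gam vs = K%:R * gam vs.
  by rewrite big_const_nat iter_addr_0 subn0 mulr_natl.
move: (\sum_(_ <= _ < _) gam _) (\sum_(_ <= _ < _) phi us _) => s1 s2.
move: (\sum_(_ <= _ < _) phi _ vs) => s3.
move: (phi _ vs) (phi us _) (gam vs) (gam _) => p1 p2 p3 p4; lra.
Qed.

(** * Vanishing steps and convergent distances to a saddle point *)

Lemma energy_gap us vs k : saddle_point Phi g us vs ->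
  (1 - kappa) / (2 * tau) * a k.+1 ^+ 2 + delta * b k.+1 ^+ 2
    <= energy us vs k - energy us vs k.+1.
Proof.
move=> sad; have [Pus gvs] := saddle_dom sa sad.
have [Px gy] := iterates_dom k.+1.
have := energy_descent k Pus gvs; have := saddle_le sa sad Px gy.
move: (energy us vs k) (energy us vs k.+1) (delta * _) (_ / _ * _).
move: (phi _ _) (phi _ _) (gam _) (gam _) => *; lra.
Qed.

Let coefA_gt0 : 0 < (1 - kappa) / (2 * tau).
Proof. by rewrite divr_gt0 ?subr_gt0 ?mulr_gt0. Qed.

Lemma energy_ge0 u v k : 0 <= energy u v k.
Proof.
apply: le_trans (energy_ge u v k); rewrite addr_ge0// mulr_ge0 ?sqr_ge0//.
by rewrite divr_ge0// mulr_ge0// ltW.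
Qed.

Lemma energy_nonincreasing us vs : saddle_point Phi g us vs ->
  nonincreasing_seq (energy us vs).
Proof.
move=> sad; apply/nonincreasing_seqP => k; rewrite -subr_ge0.
apply: le_trans (energy_gap k sad).
by rewrite addr_ge0// mulr_ge0 ?sqr_ge0// ltW.
Qed.

Lemma energy_cvg us vs : saddle_point Phi g us vs -> cvgn (energy us vs).
Proof.
move=> sad; apply: nonincreasing_is_cvgn; first exact: energy_nonincreasing.
by exists 0 => _ [k _ <-]; exact: energy_ge0.
Qed.

(** The energy stripped of its corrections: the difference of two such sequences, for two reference
    points, is affine in the iterates, as Opial's argument requires. *)
Definition weighted_dist u v k :=
  1 / (2 * tau) * `|u - x k| ^+ 2 + 1 / (2 * sigma) * `|v - y k| ^+ 2.

Section given_saddle.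
Variables (us : H) (vs : G).
Hypothesis sad : saddle_point Phi g us vs.

Let energy_diff : energy us vs k - energy us vs k.+1 @[k --> \oo] --> 0.
Proof.
have E_cvg := energy_cvg sad.
rewrite -(subrr (limn (energy us vs))); apply: cvgB => //.
by have := E_cvg; rewrite -cvg_shiftS.
Qed.

Let coef_cvg0 (z : nat -> R) C : 0 < C -> (forall k, 0 <= z k) ->
  (forall k, C * z k.+1 ^+ 2 <= energy us vs k - energy us vs k.+1) ->
  z k.+1 @[k --> \oo] --> 0.
Proof.
move=> C0 z0 zE; apply: cvg0_sqr => //.
apply: (@cvg0_le _ _ (fun k => C^-1 * (energy us vs k - energy us vs k.+1))).
  by move=> k; rewrite ger0_norm ?sqr_ge0// ler_pdivlMl.
exact: cvg0Ml energy_diff.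
Qed.

Lemma dist_x_cvg0 : `|x k.+1 - x k| @[k --> \oo] --> 0.
Proof.
apply: (coef_cvg0 (z := a) coefA_gt0) => [k|k]; first exact: normr_ge0.
apply: le_trans (energy_gap k sad).
by rewrite lerDl mulr_ge0 ?sqr_ge0.
Qed.

Lemma dist_y_cvg0 : `|y k.+1 - y k| @[k --> \oo] --> 0.
Proof.
apply: (coef_cvg0 (z := b) delta_gt0) => [k|k]; first exact: normr_ge0.
apply: le_trans (energy_gap k sad).
by rewrite lerDr mulr_ge0 ?sqr_ge0// ltW.
Qed.

Let a_cvg0 : a k @[k --> \oo] --> 0.
Proof. by rewrite -cvg_shiftS; exact: dist_x_cvg0. Qed.

Let b_cvg0 : b k @[k --> \oo] --> 0.
Proof. by rewrite -cvg_shiftS; exact: dist_y_cvg0. Qed.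

Let q_cvg0 : `|q k| @[k --> \oo] --> 0.
Proof.
apply: (@cvg0_le _ _ (fun k => Lyx * a k + Lyy * b k)).
  by move=> k; rewrite normr_id; exact: norm_q_le.
by apply: cvg0D; exact: cvg0Ml.
Qed.

Lemma iterates_bounded : exists M, forall k, `|x k| <= M /\ `|y k| <= M.
Proof.
have bounded (V : hilbertType R) (z : nat -> V) z0 C : 0 < C ->
    (forall k, C * `|z0 - z k| ^+ 2 <= energy us vs 0) ->
    exists M, forall k, `|z k| <= M.
  move=> C0 zE; exists (`|z0| + (C^-1 * energy us vs 0 + 1)) => k.
  rewrite -{1}[z k](subKr z0); apply: le_trans (ler_normB _ _) _.
  rewrite lerD2l; have := zE k; rewrite -ler_pdivlMl//.
  (* [s <= s^2 + 1] turns the bound on the square into one on the norm without a root. *)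
  have := sqr_ge0 (`|z0 - z k| - 1).
  by move: `|z0 - z k| (C^-1 * _) => s t; have := sqr_ge0 s; nra.
have E0 k : energy us vs k <= energy us vs 0.
  exact: energy_nonincreasing sad _ _ (leq0n k).
have T0 : 0 < 1 / (2 * tau) by rewrite divr_gt0// mulr_gt0.
have [|M1 xM] := bounded H x us _ T0.
  move=> k; apply: le_trans (E0 k); apply: le_trans (energy_ge _ _ k).
  by rewrite lerDl mulr_ge0 ?sqr_ge0.
have [|M2 yM] := bounded G y vs _ delta_gt0.
  move=> k; apply: le_trans (E0 k); apply: le_trans (energy_ge _ _ k).
  by rewrite lerDr mulr_ge0 ?sqr_ge0// ltW.
exists (Num.max M1 M2) => k; rewrite !le_max xM yM orbT.
by split.
Qed.

(** The right-hand side of [step_le]: each inner product pairs a vanishing vector with a bounded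
    one. *)
Lemma step_remainder_cvg0 u v :
  inner (q k.+1 - q k) (v - y k.+1)
    - inner (x k - x k.+1) (u - x k.+1) / tau
    - inner (y k - y k.+1) (v - y k.+1) / sigma @[k --> \oo] --> 0.
Proof.
have [M xyM] := iterates_bounded.
have xM k : `|u - x k.+1| <= `|u| + M.
  by apply: le_trans (ler_normB _ _) _; rewrite lerD2l (xyM _).1.
have yM k : `|v - y k.+1| <= `|v| + M.
  by apply: le_trans (ler_normB _ _) _; rewrite lerD2l (xyM _).2.
have dq : `|q k.+1 - q k| @[k --> \oo] --> 0.
  apply: (@cvg0_le _ _ (fun k => `|q k.+1| + `|q k|)).
    by move=> k; rewrite normr_id ler_normB.
  by apply: cvg0D => //; have := q_cvg0; rewrite -cvg_shiftS.
have dx : `|x k - x k.+1| @[k --> \oo] --> 0.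
  by under eq_fun do rewrite distrC; exact: dist_x_cvg0.
have dy : `|y k - y k.+1| @[k --> \oo] --> 0.
  by under eq_fun do rewrite distrC; exact: dist_y_cvg0.
have neg0 f : f k @[k --> \oo] --> (0 : R) -> - f k @[k --> \oo] --> (0 : R).
  by move=> f0; rewrite -oppr0; exact: cvgN.
apply: cvg0D; first apply: cvg0D; first exact: (inner_cvg0 dq yM).
  apply: neg0; under eq_fun do rewrite mulrC.
  exact: cvg0Ml (inner_cvg0 dx xM).
apply: neg0; under eq_fun do rewrite mulrC.
exact: cvg0Ml (inner_cvg0 dy yM).
Qed.

(** * Weak limits along ultrafilters and Opial's argument *)

Section ultralimits.
Variables (F : set_system nat).
Context {FU : UltraFilter F}.
Hypothesis ooF : \oo `<=` F.

(** [step_le] passes to the limit: its remainder vanishes, while [Phi^~ v], [g] and [- Phi u] are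
    convex and lower semicontinuous, hence weakly so. *)
Lemma ultralimit_saddle p r :
  inner_cvg F x p -> inner_cvg F y r -> saddle_point Phi g p r.
Proof.
move=> xp yr.
have x1p : inner_cvg F (fun n => x n.+1) p.
  exact: (inner_cvg_shift ooF dist_x_cvg0 xp).
have y1r : inner_cvg F (fun n => y n.+1) r.
  exact: (inner_cvg_shift ooF dist_y_cvg0 yr).
have main u v e : P u -> edom g v -> 0 < e ->
    [/\ (Phi p v < +oo)%E, (g r < +oo)%E &
      phi p v + gam r - phi u r <= gam v + e].
  move=> Pu gv e0.
  have Px k := (iterates_dom k.+1).1; have gy k := (iterates_dom k.+1).2.
  rewrite -fine_NPhi.
  apply: (@near_sum3_le _ _ F _ _ _ _ (fun k => phi (x k.+1) v)
    (fun k => gam (y k.+1)) (fun k => - phi u (y k.+1))).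
  - exact: Phi_Nninfty sa _ _.
  - exact: (g_proper sa).1.
  - exact: (NPhi_proper sa Pu).1.
  - move=> C /(inner_cvg_lsc (Phi_fst_proper sa gv) (Phi_fst_convex sa gv)
      (Phi_fst_lsc sa gv) x1p); apply: filterS => k.
    by rewrite -(dom_fst_fineK sa _ (Px k)) lte_fin.
  - move=> C /(inner_cvg_lsc (g_proper sa) (g_econvex sa) (g_lsc sa) y1r).
    by apply: filterS => k; rewrite -(gK sa (gy k)) lte_fin.
  - move=> C /(inner_cvg_lsc (NPhi_proper sa Pu) (Phi_snd_concave sa Pu)
      (NPhi_lsc sa Pu) y1r); apply: filterS => k.
    by rewrite -(dom_fst_fineK sa _ Pu) -EFinN lte_fin.
  - apply: ooF.
    have /(_ _ _ e0) := cvgr_le _ (step_remainder_cvg0 u v).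
    apply: filterS => k; have := step_le k Pu gv.
    move: (inner _ _) (inner _ _ / _) (inner _ _ / _).
    move: (phi _ _) (phi _ _) (gam _) (gam _) => *; lra.
have [Pus gvs] := saddle_dom sa sad.
(* This first use of [main] only places [p] and [r] in the domains. *)
have [Pp gr _] := main us vs 1 Pus gvs ltr01.
apply: (saddle_intro sa) => //; first by exists vs.
move=> u v Pu gv; apply/ler_addgt0Pr => e e0.
have [_ _] := main u v e Pu gv e0.
move: (phi _ _) (phi _ _) (gam _) (gam _) => *; lra.
Qed.

End ultralimits.

(** The energy converges, and the terms separating it from [weighted_dist] tend to 0. *)
Lemma weighted_dist_cvg : cvgn (weighted_dist us vs).
Proof.
have [M xyM] := iterates_bounded.
have yM k : `|vs - y k| <= `|vs| + M.
  by apply: le_trans (ler_normB _ _) _; rewrite lerD2l (xyM _).2.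
have -> : weighted_dist us vs = fun k => energy us vs k
    + (inner (q k) (vs - y k)
       + (- (kappa / (2 * tau)) * a k ^+ 2 + - (Lyy / 2) * b k ^+ 2)).
  apply/funext => k; rewrite /weighted_dist /energy.
  move: (inner _ _) (1 / _ * _) (1 / _ * _) (kappa / _) (_ / 2) => *; ring.
apply: is_cvgD; first exact: energy_cvg.
apply/cvg_ex; exists 0; apply: cvg0D; first exact: (inner_cvg0 q_cvg0 yM).
by apply: cvg0D; apply: cvg0Ml; exact: cvg0_exp2.
Qed.

End given_saddle.

(** Both limits are saddle points, so the difference [f] of the distances to them converges. Being
    affine in the iterates, [f] can be evaluated along [F1] and along [F2]; equality of the two
    values makes the weighted squared distance between the limits zero. *)
Lemma ultralimit_unique (F1 F2 : set_system nat)
    {FU1 : UltraFilter F1} {FU2 : UltraFilter F2} p1 r1 p2 r2 :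
  (exists us vs, saddle_point Phi g us vs) ->
  \oo `<=` F1 -> \oo `<=` F2 ->
  inner_cvg F1 x p1 -> inner_cvg F1 y r1 ->
  inner_cvg F2 x p2 -> inner_cvg F2 y r2 -> p1 = p2 /\ r1 = r2.
Proof.
move=> [us [vs sad]] oo1 oo2 xp1 yr1 xp2 yr2.
have sad1 : saddle_point Phi g p1 r1 by exact: (ultralimit_saddle sad oo1).
have sad2 : saddle_point Phi g p2 r2 by exact: (ultralimit_saddle sad oo2).
pose f k := weighted_dist p1 r1 k - weighted_dist p2 r2 k.
have f_cvg : cvgn f.
  exact: (is_cvgB (weighted_dist_cvg sad1) (weighted_dist_cvg sad2)).
pose L p r := 1 / tau * inner p (p2 - p1) + 1 / sigma * inner r (r2 - r1).
pose C := 1 / (2 * tau) * (`|p1| ^+ 2 - `|p2| ^+ 2)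
  + 1 / (2 * sigma) * (`|r1| ^+ 2 - `|r2| ^+ 2).
have fE k : f k = L (x k) (y k) + C.
  rewrite /f /weighted_dist /L /C !sqr_normB !innerDr !innerNr.
  rewrite (innerC p1) (innerC p2) (innerC r1) (innerC r2).
  by field; rewrite !gt_eqF.
have limE F p r : UltraFilter F -> \oo `<=` F ->
    inner_cvg F x p -> inner_cvg F y r -> limn f = L p r + C.
  move=> FU ooF xp yr.
  have fF : f k @[k --> F] --> limn f.
    by apply: cvg_trans f_cvg => A; exact: ooF.
  apply: (cvg_unique _ fF) => //.
  rewrite (funext fE); apply: cvgD; last exact: cvg_cst.
  by apply: cvgD; apply: cvgM; [exact: cvg_cst| |exact: cvg_cst|].
have : L p1 r1 = L p2 r2.
  apply: (addIr C); rewrite -(limE F1 p1 r1)//; exact: (limE _ _ _ FU2 oo2).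
rewrite /L => /eqP; rewrite eq_sym -subr_eq0.
have -> : 1 / tau * inner p2 (p2 - p1) + 1 / sigma * inner r2 (r2 - r1) -
    (1 / tau * inner p1 (p2 - p1) + 1 / sigma * inner r1 (r2 - r1)) =
    1 / tau * `|p2 - p1| ^+ 2 + 1 / sigma * `|r2 - r1| ^+ 2.
  rewrite -!inner_norm (innerDl p2) (innerDl r2) !innerNl; ring.
have nneg e (n : R) : 0 < e -> 0 <= 1 / e * n ^+ 2.
  by move=> e0; rewrite mulr_ge0 ?sqr_ge0// divr_ge0// ltW.
rewrite paddr_eq0 ?nneg//.
rewrite !mulf_eq0 !oner_eq0 !invr_eq0 (gt_eqF tau_gt0) (gt_eqF sigma_gt0)/=.
rewrite !orbb !normr_eq0 !subr_eq0 => /andP[/eqP -> /eqP ->].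
by [].
Qed.

Lemma weak_limit : (exists us vs, saddle_point Phi g us vs) ->
  exists us vs, [/\ saddle_point Phi g us vs,
    inner_cvg \oo x us & inner_cvg \oo y vs].
Proof.
move=> ex_sad; have [us0 [vs0 sad0]] := ex_sad.
have [M xyM] := iterates_bounded sad0.
have ultra (F : set_system nat) : UltraFilter F -> \oo `<=` F ->
    exists p r, inner_cvg F x p /\ inner_cvg F y r.
  move=> FU ooF; have [p xp] := bounded_inner_cvg (fun k => (xyM k).1).
  have [r yr] := bounded_inner_cvg (fun k => (xyM k).2).
  by exists p, r.
(* Any ultrafilter above [\oo] supplies the candidate; all others share its limits, so [cvg_ultra]
   gives convergence of the whole sequence. *)
have [F [FU ooF]] := ultraFilterLemma eventually_filter.
have [us [vs [xus yvs]]] := ultra F FU ooF.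
have same (F' : set_system nat) (FU' : UltraFilter F') (ooF' : \oo `<=` F') :
    inner_cvg F' x us /\ inner_cvg F' y vs.
  have [p [r [xp yr]]] := ultra F' FU' ooF'.
  by have [-> ->] := ultralimit_unique ex_sad ooF ooF' xus yvs xp yr.
exists us, vs; split; first exact: (ultralimit_saddle sad0 ooF).
- by move=> h; apply: cvg_ultra => F' FU' ooF'; exact: (same F' FU' ooF').1.
- by move=> h; apply: cvg_ultra => F' FU' ooF'; exact: (same F' FU' ooF').2.
Qed.

End iteration.

(** * Weak convergence in the product space and conclusion *)

Lemma weak_cvg_pair (R : realType) (H G : hilbertType R) (x : nat -> H)
    (y : nat -> G) p r : inner_cvg \oo x p -> inner_cvg \oo y r ->
  weak_cvg (fun k => (x k, y k)) (p, r).
Proof.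
move=> xp yr f cf.
(* A continuous functional on the product is the sum of its restrictions to the factors, each
   represented through [riesz]. *)
have fD u v : f (u, v) = f (u, 0) + f (0, v).
  by rewrite -raddfD -{1}[u]addr0 -{1}[v]add0r.
have [||s fs] := @riesz R H (fun u => f (u, 0)).
- move=> c u v; rewrite -linearP; congr (f _).
  by rewrite -[X in (_, X)](addr0 0) -[X in (_, X + _)](scaler0 _ c).
- move=> u; apply: (@continuous_comp _ _ _ (fun w => (w, 0 : G)) f);
    last exact: cf.
  by apply: cvg_pair; [exact: cvg_id|exact: cvg_cst].
have [||t ft] := @riesz R G (fun v => f (0, v)).
- move=> c u v; rewrite -linearP; congr (f _).
  by rewrite -[X in (X, _)](addr0 0) -[X in (X + _, _)](scaler0 _ c).
- move=> u; apply: (@continuous_comp _ _ _ (fun w => (0 : H, w)) f);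
    last exact: cf.
  by apply: cvg_pair; [exact: cvg_cst|exact: cvg_id].
have fE u v : f (u, v) = inner u s + inner v t.
  by rewrite fD fs ft (innerC u) (innerC v).
rewrite fE; under eq_fun do rewrite fE.
by apply: cvgD; [exact: xp|exact: yr].
Qed.

Theorem theorem8 (R : realType) (H G : hilbertType R)
    (Phi : H -> G -> \bar R) (g : G -> \bar R)
    (Lyx Lyy c_alpha tau sigma : R) (x : nat -> H) (y : nat -> G) :
  standing_assumptions Phi g 0 Lyx Lyy ->
  (exists xs ys, saddle_point Phi g xs ys) ->
  Lyx < c_alpha ->
  0 < tau ->
  0 < sigma ->
  (c_alpha * Lyx * tau + 2 * Lyy) * sigma < 1 ->
  OGAProx Phi g (fun=> tau) (fun=> sigma) (fun=> 1) x y ->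
  (exists xs ys, saddle_point Phi g xs ys /\
     weak_cvg (fun k => (x k, y k)) (xs, ys)) /\
  (forall K : nat, (1 <= K)%N ->
   forall (xs : H) (ys : G), saddle_point Phi g xs ys ->
     (0 <= Psi Phi g (ergodic_mean x K) ys - Psi Phi g xs (ergodic_mean y K)
        <= (K%:R^-1 * (1 / (2 * tau) * `|xs - x 0%N| ^+ 2
                       + 1 / (2 * sigma) * `|ys - y 0%N| ^+ 2))%:E)%E).
Proof.
move=> sa ex_sad Lc tau0 sigma0 step alg.
have dE k : grad_y Phi (x k) (y k) = grad_y Phi (x k) (y k) by [].
split.
  have [xs [ys [sad xs_lim ys_lim]]] :=
    weak_limit sa Lc tau0 sigma0 step alg dE ex_sad.
  by exists xs, ys; split=> //; exact: weak_cvg_pair.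
move=> K K0 xs ys sad.
have := ergodic_gap sa Lc tau0 sigma0 step alg dE K0 sad.
by rewrite (energy0 Lyx Lyy c_alpha).
Qed.
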